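(* Let $(X,d,p)$ be a metric space with a marked point $p$. Suppose that $X$ is midpoint convex at $p$ and that $$\liminf_{w,x,y,z\to p}A_{1}(w,x,y,z)\ge 0,$$ where $A_1:X^4\to\mathbb R$ is defined by $$A_{1}(w,x,y,z):= \frac{d^{2}(w,x)+d^{2}(x,y)+d^{2}(y,z)+d^{2}(z,w)-\bigl(d^{2}(w,y)+d^{2}(x,z)\bigr)}{\bigl(\max\{d(w,p),d(x,p),d(y,p),d(z,p)\}\bigr)^{2}}$$ for $(w,x,y,z)\neq(p,p,p,p)$ and $A_1(p,p,p,p):=0$. Then every separable tangent space $\Omega_{p,\tilde r}^{X}$ to $X$ at $p$ (for any normalizing sequence $\tilde r$) is a CAT(0)-space.
   Context: Pretangent and tangent spaces. Let $(X,d,p)$ be a metric space with marked point $p$. A normalizing sequence is a sequence $\tilde r=\{r_n\}_{n\in\mathbb N}$ of positive reals with $r_n\to 0$. Let $\tilde X$ be the set of all sequences of points of $X$. Two sequences $\tilde x=\{x_n\},\tilde y=\{y_n\}\in\tilde X$ are mutually stable with respect to $\tilde r$ if the finite limit $\tilde d_{\tilde r}(\tilde x,\tilde y):=\lim_{n\to\infty} d(x_n,y_n)/r_n$ exists. A family $\tilde F\subseteq\tilde X$ is self-stable if any two of its elements are mutually stable; it is maximal self-stable if moreover for every $\tilde z\in\tilde X\setminus\tilde F$ there is $\tilde x\in\tilde F$ such that $\tilde x,\tilde z$ are not mutually stable. Let $\tilde X_{p,\tilde r}$ denote a maximal self-stable family (with respect to $\tilde r$) containing the constant sequence $\tilde p=(p,p,\dots)$.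 Then $(\tilde X_{p,\tilde r},\tilde d_{\tilde r})$ is a pseudometric space; the metric space $(\Omega_{p,\tilde r}^{X},\rho)$ obtained from it by identifying $\tilde x,\tilde y$ whenever $\tilde d_{\tilde r}(\tilde x,\tilde y)=0$, with $\rho$ induced by $\tilde d_{\tilde r}$, is called a pretangent space to $X$ at $p$ with respect to $\tilde r$. (There may be several pretangent spaces for one $\tilde r$, depending on the choice of $\tilde X_{p,\tilde r}$.) For a strictly increasing sequence $\{n_k\}$ of natural numbers put $\tilde r'=\{r_{n_k}\}_{k}$ and $\tilde x'=\{x_{n_k}\}_k$ for $\tilde x\in\tilde X$. For every maximal self-stable (with respect to $\tilde r'$) family $\tilde X_{p,\tilde r'}\supseteq\{\tilde x':\tilde x\in\tilde X_{p,\tilde r}\}$ the map $\tilde x\mapsto\tilde x'$ induces an isometric embedding $em':\Omega_{p,\tilde r}^{X}\to\Omega_{p,\tilde r'}^{X}$. The pretangent space $\Omega_{p,\tilde r}^{X}$ is called tangent if $em'$ is bijective for every such $\{n_k\}$ and every such $\tilde X_{p,\tilde r'}$. Midpoint convexity at $p$. $X$ is midpoint convex at $p$ if for any two sequences $\tilde x=\{x_n\}$, $\tilde y=\{y_n\}$ in $X$ converging to $p$ there is a sequence $\tilde z=\{z_n\}$ in $X$ (called an infinitesimal midpoint of $\tilde x,\tilde y$) such that, with $\delta_p(x,y):=\max\{d(x,p),d(y,p)\}$, $$\lim_{n\to\infty}\frac{|d(x_n,z_n)-\frac12 d(x_n,y_n)|}{\delta_p(x_n,y_n)}=\lim_{n\to\infty}\frac{|d(y_n,z_n)-\frac12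 d(x_n,y_n)|}{\delta_p(x_n,y_n)}=0,$$ where, when $x_n=y_n=p$, the quotients are understood as $0$ if $z_n=p$ and as $+\infty$ if $z_n\ne p$. CAT(0)-space has its usual global meaning: a geodesic metric space of nonpositive curvature in the sense of Aleksandrov, i.e. geodesic triangles are not thicker than their Euclidean comparison triangles. *)

(* Defs.v *)
From HB Require Import structures.
From mathcomp Require Import all_boot all_order all_algebra.
From mathcomp Require Import all_classical all_reals all_analysis.

Set Implicit Arguments.
Unset Strict Implicit.
Unset Printing Implicit Defensive.

Import Order.TTheory GRing.Theory Num.Theory.
Import numFieldNormedType.Exports.

Local Open Scope classical_set_scope.
Local Open Scope quotient_scope.
Local Open Scope ring_scope.

Record normalizing_seq (R : realType) := NormalizingSeq {
  nseq_fun :> nat -> R ;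
  nseq_gt0 : forall n, 0 < nseq_fun n ;
  nseq_cvg0 : nseq_fun n @[n --> \oo] --> (0 : R) }.

Lemma increasing_seq_ge (k : nat -> nat) :
  increasing_seq k -> forall n, (n <= k n)%N.
Proof.
move=> ki; elim=> // n IH; apply: (leq_ltn_trans IH).
by rewrite ltnNge; apply/negP => h; move: (ki n.+1 n); rewrite leEnat h ltnn.
Qed.

Lemma increasing_seq_cvgn (k : nat -> nat) :
  increasing_seq k -> k n @[n --> \oo] --> \oo.
Proof.
move=> ki A [N _ NA]; exists N => // n /= Nn; apply: NA => /=.
exact: leq_trans Nn (increasing_seq_ge ki n).
Qed.

Definition nseq_sub (R : realType) (r : normalizing_seq R) (k : nat -> nat)
    (ki : increasing_seq k) : normalizing_seq R :=
  @NormalizingSeq R (r \o k) (fun n => nseq_gt0 r (k n))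
    (cvg_comp _ _ (increasing_seq_cvgn ki) (@nseq_cvg0 R r)).

Section pretangent.
Context {R : realType} {X : metricType R}.
Implicit Types (r : normalizing_seq R) (x y z : nat -> X).

Definition mutually_stable r x y :=
  cvgn (fun n => mdist (x n) (y n) / r n : R).

Definition stable_dist r x y : R :=
  limn (fun n => mdist (x n) (y n) / r n : R).

Definition self_stable r (F : set (nat -> X)) :=
  forall x y, F x -> F y -> mutually_stable r x y.

Definition maximal_self_stable r (F : set (nat -> X)) :=
  self_stable r F /\
  forall z, ~ F z -> exists2 x, F x & ~ mutually_stable r x z.

Record stable_family (p : X) r := StableFamily {
  family_set :> set (nat -> X) ;
  family_max : maximal_self_stable r family_set ;
  family_const : family_set (fun=> p) }.

Lemma stable_distxx r x : stable_dist r x x = 0.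
Proof.
rewrite /stable_dist (_ : (fun n => _) = fun=> 0) ?lim_cst//.
by apply/funext => n; rewrite mdistxx mul0r.
Qed.

Lemma stable_dist_sym r x y : stable_dist r x y = stable_dist r y x.
Proof. by rewrite /stable_dist; under eq_fun do rewrite metric_sym. Qed.

Lemma stable_dist_ge0 r x y : mutually_stable r x y -> 0 <= stable_dist r x y.
Proof.
move=> xy; apply: limr_ge => //; apply: nearW => n.
by rewrite divr_ge0 ?mdist_ge0// ltW ?nseq_gt0.
Qed.

Lemma stable_dist_triangle r x y z : mutually_stable r x y ->
  mutually_stable r y z -> mutually_stable r x z ->
  stable_dist r x z <= stable_dist r x y + stable_dist r y z.
Proof.
move=> xy yz xz; rewrite /stable_dist -limD//.
apply: ler_lim => //; first exact: is_cvgD.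
apply: nearW => n /=; rewrite -mulrDl ler_pM2r ?invr_gt0 ?nseq_gt0//.
exact: metric_triangle.
Qed.

End pretangent.

Section pretangent_space.
Context {R : realType} {X : metricType R} {p : X} {r : normalizing_seq R}.
Variable F : stable_family p r.

Definition family_seq := {x : nat -> X | x \in (F : set (nat -> X))}.
HB.instance Definition _ := Choice.on family_seq.
Implicit Types a b c : family_seq.

Lemma family_stable a b : mutually_stable r (val a) (val b).
Proof.
by apply: (family_max F).1; apply: set_mem; [exact: (valP a)|exact: (valP b)].
Qed.

Definition family_dist a b : R := stable_dist r (val a) (val b).

Lemma family_dist_triangle b a c :
  family_dist a c <= family_dist a b + family_dist b c.
Proof. by apply: stable_dist_triangle; exact: family_stable. Qed.

Definition family_eqv : rel family_seq := fun a b => family_dist a b == 0.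

Lemma family_eqv_refl : reflexive family_eqv.
Proof. by move=> a; rewrite /family_eqv /family_dist stable_distxx. Qed.

Lemma family_eqv_sym : symmetric family_eqv.
Proof. by move=> a b; rewrite /family_eqv /family_dist stable_dist_sym. Qed.

Lemma family_eqv_trans : transitive family_eqv.
Proof.
move=> b a c /eqP ab /eqP bc; rewrite /family_eqv eq_le.
rewrite (stable_dist_ge0 (@family_stable a c)) andbT.
by rewrite (le_trans (family_dist_triangle b a c))// ab bc addr0.
Qed.

Canonical family_equiv :=
  EquivRel family_eqv family_eqv_refl family_eqv_sym family_eqv_trans.

Definition pretangent := {eq_quot family_equiv}.
HB.instance Definition _ := Choice.on pretangent.
HB.instance Definition _ := EqQuotient.on pretangent.

Definition pretangent_dist (u v : pretangent) : R :=
  family_dist (repr u) (repr v).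

Lemma family_dist_eqv a a' b b' : family_eqv a a' -> family_eqv b b' ->
  family_dist a b = family_dist a' b'.
Proof.
suff le c c' d d' : family_eqv c c' -> family_eqv d d' ->
    family_dist c d <= family_dist c' d'.
  by move=> aa bb; apply/eqP; rewrite eq_le !le// family_eqv_sym.
rewrite [family_eqv d _]family_eqv_sym => /eqP cc /eqP dd.
rewrite (le_trans (family_dist_triangle c' c d))// cc add0r.
by rewrite (le_trans (family_dist_triangle d' c' d))// dd addr0.
Qed.

Lemma pretangent_eqP a b :
  reflect (\pi_pretangent a = \pi_pretangent b) (family_eqv a b).
Proof. by apply: (iffP idP) => [/eqmodP|/eqmodP]. Qed.

Lemma pretangent_distE a b :
  pretangent_dist (\pi_pretangent a) (\pi_pretangent b) = family_dist a b.
Proof. by apply: family_dist_eqv; apply/pretangent_eqP; rewrite reprK. Qed.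

Lemma pretangent_distxx u : pretangent_dist u u = 0.
Proof. exact: stable_distxx. Qed.

Lemma pretangent_dist_eq0 u v : pretangent_dist u v = 0 -> u = v.
Proof.
move=> uv; rewrite -[u]reprK -[v]reprK.
by apply/pretangent_eqP; rewrite /family_eqv -/(pretangent_dist u v) uv.
Qed.

Lemma pretangent_dist_sym u v : pretangent_dist u v = pretangent_dist v u.
Proof. exact: stable_dist_sym. Qed.

Lemma pretangent_dist_triangle v u w :
  pretangent_dist u w <= pretangent_dist u v + pretangent_dist v w.
Proof. exact: family_dist_triangle. Qed.

HB.instance Definition _ := isMetric.Build R pretangent pretangent_distxx
  pretangent_dist_eq0 pretangent_dist_sym pretangent_dist_triangle.

End pretangent_space.

Section tangent.
Context {R : realType} {X : metricType R} {p : X} {r : normalizing_seq R}.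

Section embedding.
Variables (F : stable_family p r) (k : nat -> nat) (ki : increasing_seq k).
Variable F' : stable_family p (nseq_sub r ki).
Hypothesis FF' : [set x \o k | x in F] `<=` F'.

Definition family_sub (a : family_seq F) : family_seq F' :=
  exist _ (val a \o k) (mem_set (FF' (imageP _ (set_mem (valP a))))).

Definition pretangent_emb (u : pretangent F) : pretangent F' :=
  \pi_(pretangent F') (family_sub (repr u)).

Lemma family_sub_dist a b :
  family_dist (family_sub a) (family_sub b) = family_dist a b.
Proof.
apply: cvg_lim; first exact: Rhausdorff.
have ab : (fun n => mdist (val a n) (val b n) / r n : R) @ \oo
    --> family_dist a b by exact: family_stable.
exact: cvg_comp (increasing_seq_cvgn ki) ab.
Qed.

(* [pretangent_emb] does not depend on the chosen representatives. *)
Lemma pretangent_embE a :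
  pretangent_emb (\pi_(pretangent F) a) = \pi_(pretangent F') (family_sub a).
Proof.
apply/pretangent_eqP; rewrite /family_eqv family_sub_dist.
by apply/pretangent_eqP; rewrite reprK.
Qed.

Lemma pretangent_emb_isometry u v :
  mdist (pretangent_emb u) (pretangent_emb v) = mdist u v.
Proof. by rewrite /mdist/= pretangent_distE family_sub_dist. Qed.

End embedding.

Definition tangent (F : stable_family p r) :=
  forall (k : nat -> nat) (ki : increasing_seq k)
    (F' : stable_family p (nseq_sub r ki))
    (FF' : [set x \o k | x in F] `<=` F'),
  bijective (pretangent_emb FF').

End tangent.

Section infinitesimal_conditions.
Context {R : realType} {X : metricType R}.
Variable p : X.

Definition delta_at (x y : X) : R := Num.max (mdist x p) (mdist y p).

(* The quotient |d(x, z) - d(x, y) / 2| / delta_p(x, y) with its convention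
   at x = y = p; the first of [x], [y] is the one compared with [z]. *)
Definition midpoint_defect (x y z : X) : \bar R :=
  if (x == p) && (y == p) then (if z == p then 0%E else +oo%E)
  else (`|mdist x z - 2^-1 * mdist x y| / delta_at x y)%:E.

Definition midpoint_convex :=
  forall x y : nat -> X, x n @[n --> \oo] --> p -> y n @[n --> \oo] --> p ->
  exists z : nat -> X,
    midpoint_defect (x n) (y n) (z n) @[n --> \oo] --> 0%E /\
    midpoint_defect (y n) (x n) (z n) @[n --> \oo] --> 0%E.

Definition A1 (w x y z : X) : R :=
  if (w, x, y, z) == (p, p, p, p) then 0 else
  (mdist w x ^+ 2 + mdist x y ^+ 2 + mdist y z ^+ 2 + mdist z w ^+ 2
     - (mdist w y ^+ 2 + mdist x z ^+ 2))
  / Num.max (Num.max (mdist w p) (mdist x p))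
            (Num.max (mdist y p) (mdist z p)) ^+ 2.

End infinitesimal_conditions.

Definition separable (T : topologicalType) :=
  exists2 D : set T, countable D & dense D.

(* The Euclidean distance on the plane (the norm carried by ['rV[R]_2] is the
   supremum norm). *)
Definition plane_dist (R : realType) (u v : 'rV[R]_2) : R :=
  Num.sqrt (\sum_(i < 2) (u 0 i - v 0 i) ^+ 2).

Section CAT0.
Context {R : realType}.

Definition geodesic (T : Type) (d : T -> T -> R) (x y : T) (c : R -> T) :=
  [/\ c 0 = x, c (d x y) = y &
      {in `[0, d x y] &, forall s t, d (c s) (c t) = `|s - t|}].

(* The side [c i] runs from the vertex [x i] to the cyclically next vertex. *)
Definition geodesic_triangle (T : Type) (d : T -> T -> R)
    (x : 'I_3 -> T) (c : 'I_3 -> R -> T) :=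
  forall i, geodesic d (x i) (x (ordS i)) (c i).

Definition geodesic_space (T : metricType R) :=
  forall x y : T, exists c, geodesic mdist x y c.

(* As sides are parametrized by arc length from corresponding vertices,
   [c' i s] is the comparison point of [c i s]. *)
Definition CAT0 (T : metricType R) :=
  geodesic_space T /\
  forall (x : 'I_3 -> T) c (x' : 'I_3 -> 'rV[R]_2) c',
    geodesic_triangle mdist x c ->
    geodesic_triangle (@plane_dist R) x' c' ->
    (forall i, plane_dist (x' i) (x' (ordS i)) = mdist (x i) (x (ordS i))) ->
    forall i j s t,
      s \in `[0, mdist (x i) (x (ordS i))] ->
      t \in `[0, mdist (x j) (x (ordS j))] ->
      mdist (c i s) (c j t) <= plane_dist (c' i s) (c' j t).

End CAT0.

(* Main.v *)
Require Import Defs.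
From mathcomp Require Import all_boot all_order all_algebra.
From mathcomp Require Import all_classical all_reals all_analysis.
From mathcomp Require Import ring lra.

Set Implicit Arguments.
Unset Strict Implicit.
Unset Printing Implicit Defensive.

Import Order.TTheory GRing.Theory Num.Theory.
Import numFieldNormedType.Exports.

Local Open Scope classical_set_scope.
Local Open Scope quotient_scope.
Local Open Scope ring_scope.

(* The liminf condition passes to the limit as the quadrilateral inequality
     d(w,y)^2 + d(x,z)^2 <= d(w,x)^2 + d(x,y)^2 + d(y,z)^2 + d(z,w)^2
   on every pretangent space, and pretangent spaces are complete by a diagonal
   argument. In a separable tangent space an infinitesimal midpoint becomes an
   actual midpoint after passing to a subsequence.

   A space with midpoints and the quadrilateral inequality satisfies the CN
   inequality (Berg and Nikolaev); the proof below uses midpoints only.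
   1. Busemann convexity. If b, n are the midpoints of a, c and of a, v, then
      d(b,n) <= d(c,v) by three quadrilaterals. A bound
      d(b,n)^2 <= k d(c,v)^2 improves to the constant k/2 + 1/8: subdivide
      [c, v] into K pieces, add up the inequalities of the small parallelograms
      and let K tend to infinity. Hence d(b,n) <= d(c,v)/2.
   2. For m the midpoint of x, y put
      E(z;x,y) = d(z,x)^2 + d(z,y)^2 - 2 d(z,m)^2 - d(x,y)^2 / 2.
      Step 1 gives E(x;m,z) + E(z;m,x) >= 0, hence
      E(z;x,y) >= E(z;x',y') + E(z';x,y), where x', y', z' are the midpoints of
      m and x, y, z. So E, divided by d(m,x) d(m,z), is superharmonic under
      these halvings, and it is bounded below by -d(m,z)/d(m,x) and by
      -4 d(m,x)/d(m,z); therefore E >= 0. *)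

(** * Inequalities for real numbers *)

Lemma exists_lt_exp2 (R : realType) (x : R) : exists n, x < 2 ^+ n.
Proof.
have [n xn] : exists n, x < n%:R.
  by exists (Num.truncn x).+1; exact: truncnS_gt.
exists n; apply: (lt_trans xn).
by rewrite -natrX ltr_nat ltn_expl.
Qed.

Lemma le_of_forall_exp2 (R : realType) (x y c : R) :
  (forall n, x <= y + c / 2 ^+ n) -> x <= y.
Proof.
move=> xyc; rewrite leNgt; apply/negP => yx.
have [n] := exists_lt_exp2 (c / (x - y)).
rewrite ltr_pdivrMr ?subr_gt0// => cn.
have := xyc n; rewrite -lerBlDl ler_pdivlMr ?exprn_gt0//.
by rewrite mulrC leNgt cn.
Qed.

Lemma sqr_half_le (R : realFieldType) (p q s : R) :
  0 <= s -> s <= p + q -> s ^+ 2 / 2 <= p ^+ 2 + q ^+ 2.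
Proof.
move=> s0 spq; have : s ^+ 2 <= (p + q) ^+ 2.
  by rewrite ler_pXn2r// nnegrE// (le_trans s0).
have := sqr_ge0 (p - q); lra.
Qed.

(* A pair [(i, j)] almost attaining the supremum passes this on to all
   [(i, j + k)]; multiplying the two bounds, the ratio [2 ^ i / 2 ^ j]
   disappears. *)
Lemma subharmonic_quadrant_le0 (R : realType) (S : nat -> nat -> R) (D D' : R) :
  0 <= D -> 0 <= D' ->
  (forall i j, S i j <= D * 2 ^+ i / 2 ^+ j) ->
  (forall i j, S i j <= D' * 2 ^+ j / 2 ^+ i) ->
  (forall i j, 2 * S i j <= S i.+1 j + S i j.+1) ->
  S 0%N 0%N <= 0.
Proof.
move=> D0 D'0 SD SD' Ssub.
pose A := [set S ij.1 ij.2 | ij in [set: nat * nat]].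
have AS i j : A (S i j) by exists (i, j).
have p2 n : 0 < 2 ^+ n :> R by rewrite exprn_gt0.
have quot_le1 i j : (i <= j)%N -> 2 ^+ i / 2 ^+ j <= 1 :> R.
  by move=> ij; rewrite ler_pdivrMr// mul1r ler_weXn2l// ler1n.
have Aub : has_ubound A.
  exists (D + D') => _ [[i j] _ <-]/=.
  have [ij|/ltnW ji] := leqP i j.
  - apply: (le_trans (SD i j)); rewrite -mulrA.
    by have := ler_wpM2l D0 (quot_le1 _ _ ij); lra.
  - apply: (le_trans (SD' i j)); rewrite -mulrA.
    by have := ler_wpM2l D'0 (quot_le1 _ _ ji); lra.
have Asup : has_sup A by split => //; exists (S 0%N 0%N).
have Sle i j : S i j <= sup A by exact: ub_le_sup.
rewrite leNgt; apply/negP => S00.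
have s0 : 0 < sup A by exact: lt_le_trans S00 (Sle _ _).
have [k] := exists_lt_exp2 (4 * (D * D') / sup A ^+ 2).
rewrite ltr_pdivrMr ?exprn_gt0// => kD.
(* The gap to [sup A] at most doubles with each step in [j], so after [k] steps it is at most
   [2 ^+ k * e = sup A / 2]. *)
pose e := sup A / 2 ^+ k.+1.
have e0 : 0 < e by rewrite divr_gt0.
have [_ [[i j] _ <-]/= Sij] := sup_adherent e0 Asup.
have near l : sup A - 2 ^+ l * e <= S i (j + l)%N.
  elim: l => [|l IH]; first by rewrite addn0 mul1r ltW.
  rewrite addnS exprS; have := Ssub i (j + l)%N; have := Sle i.+1 (j + l)%N.
  lra.
have half1 : sup A / 2 <= S i (j + k)%N.
  apply: le_trans (near k); rewrite /e exprS.
  rewrite (_ : 2 ^+ k * (sup A / (2 * 2 ^+ k)) = sup A / 2); first lra.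
  by field; rewrite lt0r_neq0.
have half2 : sup A / 2 <= S i j.
  apply: le_trans (ltW Sij); rewrite /e exprS invfM mulrA.
  have : sup A / 2 / 2 ^+ k <= sup A / 2.
    by rewrite ler_pdivrMr// ler_peMr//; [lra|rewrite exprn_ege1// ler1n].
  lra.
have s2 : 0 <= sup A / 2 by lra.
have := ler_pM s2 s2 (le_trans half1 (SD _ _)) (le_trans half2 (SD' _ _)).
rewrite exprD (_ : D * _ / _ * _ = D * D' / 2 ^+ k); last first.
  by field; rewrite !lt0r_neq0.
rewrite ler_pdivlMr//; lra.
Qed.

(** * The quadrilateral inequality in spaces with midpoints *)

Section midpoint_spaces.
Context {R : realType} {T : metricType R}.
Local Notation d := (@mdist R T).
Implicit Types a b c m n v x y z : T.

Definition is_midpoint m x y := d x m = d x y / 2 /\ d y m = d x y / 2.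

Definition has_midpoints := forall x y, exists m, is_midpoint m x y.

Definition quadrilateral_inequality := forall w x y z,
  d w y ^+ 2 + d x z ^+ 2 <=
    d w x ^+ 2 + d x y ^+ 2 + d y z ^+ 2 + d z w ^+ 2.

Lemma dyadic_chain : has_midpoints -> forall k x y, exists c : nat -> T,
  [/\ c 0%N = x, c (2 ^ k)%N = y &
      forall i, (i < 2 ^ k)%N -> d (c i) (c i.+1) = d x y / 2 ^+ k].
Proof.
move=> mid; elim=> [|k IH] x y.
  exists (fun i => if i == 0%N then x else y); split => // i.
  by rewrite expn0 ltnS leqn0 => /eqP ->/=; rewrite expr0 divr1.
have [m [xm ym]] := mid x y.
have [c1 [c10 c11 c1d]] := IH x m.
have [c2 [c20 c21 c2d]] := IH m y.
exists (fun i => if (i < 2 ^ k)%N then c1 i else c2 (i - 2 ^ k)%N).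
rewrite expn_gt0 /= expnS mul2n -addnn ltnNge leq_addr /= addnK; split => // i ik.
have e2 : d x y / 2 ^+ k.+1 = d x y / 2 / 2 ^+ k by rewrite exprS invfM mulrA.

have [ik1|ik1] := ltnP i (2 ^ k); last first.
  rewrite ltnNge (leqW ik1)/= subSn// c2d ?e2 1?(metric_sym m) ?ym//.
  by rewrite ltn_subLR // addnn -mul2n -expnS.
have [ik2|ik2] := ltnP i.+1 (2 ^ k); first by rewrite c1d// xm e2.
have iE : i.+1 = (2 ^ k)%N by apply/eqP; rewrite eqn_leq ik1.
by rewrite iE subnn c20 -c11 -iE c1d// xm e2.
Qed.

(** The even and the odd indices give two interleaved paths from [b 0], the odd one entered through
    [b 1]. *)
Lemma two_step_chain (b : nat -> T) N :
  d (b 0%N) (b N) + d (b 0%N) (b N.+1) <=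
  d (b 0%N) (b 1%N) + \sum_(i < N) d (b i) (b i.+2).
Proof.
elim: N => [|N IH]; first by rewrite big_ord0 mdistxx addr0 add0r.
rewrite big_ord_recr/=; have := metric_triangle (b 0%N) (b N) (b N.+2).
lra.
Qed.

Section quadrilateral.
Hypotheses (mid : has_midpoints) (quad : quadrilateral_inequality).

(** With [m] the midpoint of [x] and [x'], the terms in [d m y] and [d m y'] of two quadrilaterals
    cancel. *)
Lemma quadrilateral_half x x' y y' :
  d x y' ^+ 2 + d x' y ^+ 2 <=
  d x y ^+ 2 + d x' y' ^+ 2 + d x x' ^+ 2 / 2 + 2 * d y y' ^+ 2.
Proof.
have [m [xm x'm]] := mid x x'.
have := quad x m y' y; have := quad m x' y' y.
rewrite (metric_sym m x') (metric_sym y' y) (metric_sym y m) (metric_sym y x).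
rewrite xm x'm; lra.
Qed.

(** A weak CN inequality (CN has [2 * d z m ^+ 2]), from the quadrilateral [z, x, m, y]. *)
Lemma quadrilateral_midpoint z x y m : is_midpoint m x y ->
  d z m ^+ 2 + d x y ^+ 2 / 2 <= d z x ^+ 2 + d z y ^+ 2.
Proof.
move=> [xm ym]; have := quad z x m y.
by rewrite xm (metric_sym m y) ym (metric_sym y z); lra.
Qed.

(** The weak CN inequalities for [n] over [[a, c]] and [b] over [[a, v]], added to the quadrilateral
    [b, n, v, c], cancel [d b v] and [d c n]. *)
Lemma midpoints_dist_le a c v b n : is_midpoint b a c -> is_midpoint n a v ->
  d b n ^+ 2 <= d c v ^+ 2.
Proof.
move=> bm nm; have [ab cb] := bm; have [an vn] := nm.
have := quadrilateral_midpoint n bm; have := quadrilateral_midpoint b nm.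
have := quad b n v c.
rewrite (metric_sym n b) (metric_sym n a) (metric_sym b a) (metric_sym n v).
rewrite (metric_sym v c) ab cb an vn; lra.
Qed.

(** The case [k = 1] is [midpoints_dist_le]; [k = 1/4] is Busemann convexity. *)
Definition midpoints_dist_le_factor (k : R) := forall a c v b n,
  is_midpoint b a c -> is_midpoint n a v -> d b n ^+ 2 <= k * d c v ^+ 2.

(* Sum the quadrilateral inequality over the parallelograms with diagonals
   [b_(i-1), b_(i+1)] and [a, v_i], where the [v_i] subdivide a segment and
   [b_i] is the midpoint of [a] and [v_i]; the lengths of the diagonals
   [b_i, v_(i+1)] telescope. *)
Lemma midpoint_fan (k e : R) a (v b : nat -> T) K :
  midpoints_dist_le_factor k ->
  (forall i, is_midpoint (b i) a (v i)) ->
  (forall i, (i <= K)%N -> d (v i) (v i.+1) = e) ->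
  \sum_(i < K) d (b i) (b i.+2) ^+ 2 <= K.+1%:R * ((2 * k + 2^-1) * e ^+ 2).
Proof.
move=> Hk bm ve.
pose r := (2 * k + 2^-1) * e ^+ 2.
(* The telescoping term: nonnegative by the triangle inequality through [b i], while [psi 0] costs
   one more [r], hence the factor [K.+1]. *)
pose psi i := d (v i.+1) (b i) ^+ 2 + d a (v i) ^+ 2 / 4
              - d a (v i.+1) ^+ 2 / 2.
have cross i : (i <= K)%N -> d (v i) (b i.+1) ^+ 2 + d (v i.+1) (b i) ^+ 2 <=
    d a (v i) ^+ 2 / 4 + d a (v i.+1) ^+ 2 / 4 + r.
  move=> iK; have := quadrilateral_half (v i) (v i.+1) (b i) (b i.+1).
  have := Hk _ _ _ _ _ (bm i) (bm i.+1).
  have [_ ->] := bm i; have [_ ->] := bm i.+1; rewrite ve// /r; lra.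
have psi_ge0 i : 0 <= psi i.
  have := sqr_half_le (mdist_ge0 (v i.+1) a) (metric_triangle (v i.+1) (b i) a).
  rewrite (metric_sym (v i.+1) a) (metric_sym (b i) a) (bm i).1 /psi; lra.
have psi0 : psi 0%N <= r.
  have := sqr_half_le (mdist_ge0 (v 0%N) a)
    (metric_triangle (v 0%N) (b 1%N) a).
  have := cross 0%N isT.
  rewrite (metric_sym (v 0%N) a) (metric_sym (b 1%N) a) (bm 1%N).1 /psi; lra.
have step i : (i < K)%N ->
    d (b i) (b i.+2) ^+ 2 <= r + psi i - psi i.+1.
  move=> iK; have := quad (b i) a (b i.+2) (v i.+1).
  have := cross i.+1 iK; rewrite /psi (metric_sym (b i) a).
  rewrite (metric_sym (b i.+2) (v i.+1)) (bm i).1 (bm i.+2).1; lra.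
rewrite -/r; have : forall N, (N <= K)%N ->
    \sum_(i < N) d (b i) (b i.+2) ^+ 2 <= N.+1%:R * r - psi N.
  elim=> [_|N IH NK]; first by rewrite big_ord0 mul1r subr_ge0.
  rewrite big_ord_recr/= -(natr1 N.+1) mulrDl mul1r.
  by have := IH (ltnW NK); have := step N NK; lra.
by move=> /(_ K (leqnn K)); have := psi_ge0 K; lra.
Qed.

Lemma midpoints_dist_le_improve (k : R) : 0 <= k ->
  midpoints_dist_le_factor k -> midpoints_dist_le_factor (k / 2 + 8^-1).
Proof.
move=> k0 Hk a c v b n bm nm.
have [cv0|cv0] := eqVneq (d c v) 0.
  have := midpoints_dist_le bm nm; rewrite cv0 expr0n/= mulr0; exact.
have {}cv0 : 0 < d c v by rewrite lt_neqAle eq_sym cv0 mdist_ge0.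
pose s := Num.sqrt (2 * k + 2^-1).
have s2 : s ^+ 2 = 2 * k + 2^-1 by rewrite sqr_sqrtr//; lra.
have s0 : 0 < s by rewrite sqrtr_gt0; lra.
suff bns : 2 * d b n <= s * d c v.
  have := ler_pM _ _ bns bns; rewrite !mulr_ge0 ?mdist_ge0//= => /(_ isT isT).
  have -> : s * d c v * (s * d c v) = s ^+ 2 * d c v ^+ 2 by ring.
  rewrite s2; lra.
(* The error [2 * d c v / 2 ^+ j] pays for the first and the last piece of the fan. *)
apply: (@le_of_forall_exp2 _ _ _ (2 * d c v)) => j.
have [w [w0 wK wd]] := dyadic_chain mid j c v.
have [b' bm'] := choice (fun i => mid a (w i)).
pose K := (2 ^ j)%N.
have [K' KE] : exists K', K = K'.+1 by exists K.-1; rewrite prednK ?expn_gt0.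
pose beta i := if i == 0%N then b else if i == K then n else b' i.
have betam i : is_midpoint (beta i) a (w i).
  rewrite /beta; case: eqVneq => [->|_]; first by rewrite w0.
  by case: eqVneq => [->|_//]; rewrite wK.
pose e := d c v / 2 ^+ j.
have e0 : 0 < e by rewrite divr_gt0// exprn_gt0.
have we i : (i <= K')%N -> d (w i) (w i.+1) = e.
  by move=> iK; rewrite wd// -/K KE ltnS.
have Ke : K%:R * e = d c v.
  by rewrite /e /K natrX mulrCA divff ?mulr1// expf_neq0.
have short i : (i <= K')%N -> d (beta i) (beta i.+1) <= e.
  move=> iK; rewrite -(@ler_pXn2r _ 2)// ?nnegrE ?mdist_ge0 ?(ltW e0)//.
  by rewrite -(we i)//; exact: midpoints_dist_le.
(* AM-GM against [s * e]: the squares sum to at most [K * (s * e) ^+ 2] by the fan, and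
   [K * e = d c v]. *)
have hsum : \sum_(i < K') d (beta i) (beta i.+2) <= s * d c v.
  have se0 : 0 < s * e by rewrite mulr_gt0.
  rewrite -(ler_pM2l se0).
  have : \sum_(i < K') (s * e * d (beta i) (beta i.+2)) <=
      \sum_(i < K') (d (beta i) (beta i.+2) ^+ 2 / 2 + (s * e) ^+ 2 / 2).
    by apply: ler_sum => i _; have := sqr_ge0 (d (beta i) (beta i.+2) - s * e);
      lra.
  rewrite -mulr_sumr big_split/= -mulr_suml sumr_const card_ord -[_ *+ K']mulr_natl.
  have := midpoint_fan Hk betam we; rewrite -KE -s2 => fan.
  have -> : s * e * (s * d c v) = K%:R * (s ^+ 2 * e ^+ 2).
    by rewrite -Ke; ring.
  move=> /le_trans; apply.
  have se2 : 0 <= s ^+ 2 * e ^+ 2 by rewrite mulr_ge0 ?sqr_ge0.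
  have : K'%:R * (s ^+ 2 * e ^+ 2) <= K%:R * (s ^+ 2 * e ^+ 2).
    by rewrite ler_wpM2r// ler_nat KE.
  have -> : (s * e) ^+ 2 = s ^+ 2 * e ^+ 2 by ring.
  lra.
have := two_step_chain beta K'.
have := metric_triangle (beta 0%N) (beta K') (beta K'.+1).
have := short K' (leqnn _); have := short 0%N isT.
rewrite -KE [beta 0%N]/beta/= [beta K]/beta eqxx.
have -> : (K == 0)%N = false by rewrite KE.
rewrite -[2 * d c v / _]mulrA -/e; lra.
Qed.

(** [1/4] is the fixed point of [k / 2 + 1/8]; starting from [k = 1], the excess [3/4] halves each
    time. *)
Lemma midpoints_dist_le_half a c v b n : is_midpoint b a c ->
  is_midpoint n a v -> d b n ^+ 2 <= d c v ^+ 2 / 4.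
Proof.
move=> bm nm; apply: (@le_of_forall_exp2 _ _ _ (3 / 4 * d c v ^+ 2)) => j.
suff H : midpoints_dist_le_factor (4^-1 + 3 / 4 / 2 ^+ j).
  by have := H _ _ _ _ _ bm nm; rewrite mulrDl mulrAC (mulrC _^-1).
elim: j => [|j IH].
  move=> a' c' v' b' n' /midpoints_dist_le H /H.
  by rewrite expr0; lra.
have j0 : 0 <= (2 ^+ j : R)^-1 by rewrite invr_ge0 exprn_ge0.
have := midpoints_dist_le_improve _ IH; rewrite exprS invfM.
have -> : (4^-1 + 3 / 4 / 2 ^+ j) / 2 + 8^-1 =
   4^-1 + 3 / 4 * (2^-1 / 2 ^+ j) :> R by field; rewrite expf_neq0.
by apply; lra.
Qed.

(** This is [E(c;a,v) + E(v;a,c) >= 0]: Busemann convexity inserted into [quadrilateral_half]. *)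
Lemma half_triangle a c v b n : is_midpoint b a c -> is_midpoint n a v ->
  d c n ^+ 2 + d v b ^+ 2 <= d a c ^+ 2 / 4 + d a v ^+ 2 / 4 + d c v ^+ 2.
Proof.
move=> bm nm; have := midpoints_dist_le_half bm nm.
have := quadrilateral_half c v b n.
rewrite bm.2 nm.2; lra.
Qed.

(** The path through [m] bounds [d x' y'] above and the path [x, x', y', y] bounds it below, both by
    [d x y / 2]. *)
Lemma is_midpoint_shrink m x y x' y' : is_midpoint m x y ->
  is_midpoint x' m x -> is_midpoint y' m y -> is_midpoint m x' y'.
Proof.
move=> [xm ym] [mx' xx'] [my' yy'].
have x'y' : d x' y' = d x y / 2.
  apply/eqP; rewrite eq_le; apply/andP; split.
    have := metric_triangle x' m y'.
    by rewrite (metric_sym x' m) mx' my' !(metric_sym m) xm ym; lra.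
  have := metric_triangle x x' y; have := metric_triangle x' y' y.
  by rewrite xx' (metric_sym y' y) yy' !(metric_sym m) xm ym; lra.
split; rewrite metric_sym x'y'.
  by rewrite mx' (metric_sym m x) xm.
by rewrite my' (metric_sym m y) ym.
Qed.

Lemma iter_halfway m (f : T -> T) x i : (forall u, is_midpoint (f u) m u) ->
  d m (iter i f x) = d m x / 2 ^+ i.
Proof.
move=> fm; elim: i => [|i IH]; first by rewrite divr1.
by rewrite iterS (fm _).1 IH exprS invfM mulrA mulrAC.
Qed.

(** The bound [E(z;x,y) >= - d x y ^+ 2], strong for a short base; [quadrilateral_midpoint] gives
    [- d z m ^+ 2], strong for a short median. *)
Lemma midpoint_dist_le_base z x y m : is_midpoint m x y ->
  2 * d z m ^+ 2 <= d z x ^+ 2 + d z y ^+ 2 + d x y ^+ 2 / 2.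
Proof.
move=> [xm ym]; have [b bm] := mid y z.
have m' : is_midpoint m y x by split; rewrite (metric_sym y x).
have := half_triangle bm m'.
have := sqr_half_le (mdist_ge0 x z) (metric_triangle x b z).
rewrite (metric_sym b z) bm.2.
by rewrite (metric_sym x z) (metric_sym y z) (metric_sym y x); lra.
Qed.

(* The CN inequality of Bruhat and Tits: its defect is superadditive under
   halving either the segment [z, m] or the segment [x, y]. *)
Lemma cn_inequality z x y m : is_midpoint m x y ->
  2 * d z m ^+ 2 + d x y ^+ 2 / 2 <= d z x ^+ 2 + d z y ^+ 2.
Proof.
move=> mxy; have [f fm] := choice (mid m).
pose X i := iter i f x; pose Y i := iter i f y; pose Z j := iter j f z.
pose h i := d x y / 2 / 2 ^+ i; pose L j := d m z / 2 ^+ j.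
have mX i : d m (X i) = h i by rewrite iter_halfway// metric_sym mxy.1.
have mY i : d m (Y i) = h i by rewrite iter_halfway// metric_sym mxy.2.
have mZ j : d m (Z j) = L j by rewrite iter_halfway.
have mXY i : is_midpoint m (X i) (Y i).
  by elim: i => [//|i IH]; exact: is_midpoint_shrink IH (fm _) (fm _).
have XY i : d (X i) (Y i) = 2 * h i.
  by have := (mXY i).1; rewrite metric_sym mX; lra.
pose E i j := d (Z j) (X i) ^+ 2 + d (Z j) (Y i) ^+ 2
              - 2 * L j ^+ 2 - 2 * h i ^+ 2.
have hS i : h i.+1 = h i / 2 by rewrite /h exprS invfM mulrA mulrAC.
have LS i : L i.+1 = L i / 2 by rewrite /L exprS invfM mulrA mulrAC.
have Esup i j : E i.+1 j + E i j.+1 <= E i j.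
  have := half_triangle (fm (X i)) (fm (Z j)).
  have := half_triangle (fm (Y i)) (fm (Z j)).
  rewrite -/(X i.+1) -/(Y i.+1) -/(Z j.+1) mX mY mZ /E hS LS.
  rewrite !(metric_sym (X i)) !(metric_sym (Y i)); lra.
have p2 i : 2 ^+ i != 0 :> R by rewrite expf_neq0.
(* The factor [2 ^+ i * 2 ^+ j] turns superadditivity of [E] into the averaging inequality for
   [S]. *)
pose S i j := - (2 ^+ i * 2 ^+ j * E i j).
have := @subharmonic_quadrant_le0 _ S (d m z ^+ 2) (d x y ^+ 2).
rewrite !sqr_ge0 => /(_ isT isT) => H.
suff : S 0%N 0%N <= 0.
  rewrite /S /E /h /L /X /Y /Z /= !expr0 (metric_sym m z); lra.
apply: H => i j.
- rewrite /S (_ : _ / _ = 2 ^+ i * 2 ^+ j * L j ^+ 2); last first.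
    by rewrite /L; field.
  rewrite -mulrN ler_wpM2l ?mulr_ge0 ?exprn_ge0//.
  have := quadrilateral_midpoint (Z j) (mXY i).
  by rewrite (metric_sym _ m) mZ XY /E; lra.
- rewrite /S (_ : _ / _ = 2 ^+ i * 2 ^+ j * (4 * h i ^+ 2)); last first.
    by rewrite /h; field.
  rewrite -mulrN ler_wpM2l ?mulr_ge0 ?exprn_ge0//.
  have := midpoint_dist_le_base (Z j) (mXY i).
  by rewrite (metric_sym _ m) mZ XY /E; lra.
- have : 0 <= 2 ^+ i * 2 ^+ j * (E i j - (E i.+1 j + E i j.+1)) :> R.
    by rewrite !mulr_ge0 ?exprn_ge0 ?subr_ge0.
  rewrite /S !exprS; lra.
Qed.

End quadrilateral.
End midpoint_spaces.

(** * Complete spaces satisfying the CN inequality *)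

Lemma plane_dist_ge0 (R : realType) (u v : 'rV[R]_2) : 0 <= plane_dist u v.
Proof. exact: sqrtr_ge0. Qed.

Lemma plane_dist_sqr (R : realType) (u v : 'rV[R]_2) :
  plane_dist u v ^+ 2 = (u 0 0 - v 0 0) ^+ 2 + (u 0 1 - v 0 1) ^+ 2.
Proof.
rewrite /plane_dist sqr_sqrtr; last by rewrite sumr_ge0// => i _; rewrite sqr_ge0.
by rewrite !big_ord_recl big_ord0 addr0; congr (_ + (_ - v _ _) ^+ 2);
  [congr (u _ _)|]; exact: val_inj.
Qed.

Lemma plane_dist_sym (R : realType) (u v : 'rV[R]_2) :
  plane_dist u v = plane_dist v u.
Proof. by rewrite /plane_dist; under eq_bigr do rewrite -sqrrN opprB. Qed.

Lemma plane_distxx (R : realType) (u : 'rV[R]_2) : plane_dist u u = 0.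
Proof.
rewrite /plane_dist big1 ?sqrtr0// => i _.
by rewrite subrr expr0n.
Qed.

(** Stewart's theorem, the equality case of [cn_along_geodesic]. *)
Lemma plane_stewart (R : realType) (z x y : 'rV[R]_2) (c : R -> 'rV[R]_2) (s : R) :
  geodesic (@plane_dist R) x y c -> 0 <= s <= plane_dist x y ->
  plane_dist x y * plane_dist z (c s) ^+ 2 =
  (plane_dist x y - s) * plane_dist z x ^+ 2 + s * plane_dist z y ^+ 2
    - s * (plane_dist x y - s) * plane_dist x y.
Proof.
move=> [c0 cl cd] /andP[s0 sl].
have l0 : 0 <= plane_dist x y by exact: plane_dist_ge0.
have xw : plane_dist (c s) x ^+ 2 = s ^+ 2.
  rewrite -[in LHS]c0 cd ?in_itv/= ?lexx ?s0 ?sl ?l0//.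
  by rewrite subr0 ger0_norm.
have wy : plane_dist y (c s) ^+ 2 = (plane_dist x y - s) ^+ 2.
  rewrite -[in LHS]cl cd ?in_itv/= ?lexx ?s0 ?sl ?l0//.
  by rewrite real_normK ?num_real.
have := plane_dist_sqr x y; move: xw wy; rewrite !(plane_dist_sqr z).
rewrite (plane_dist_sqr (c s)) (plane_dist_sqr y).
move: (plane_dist x y) l0 sl => l l0 sl.
move: (c s 0 0) (c s 0 1) (x 0 0) (x 0 1) (y 0 0) (y 0 1) (z 0 0) (z 0 1).
move=> w1 w2 x1 x2 y1 y2 z1 z2 xw wy xy.
(* The vector [(k1, k2)] is [l * c s - ((l - s) * x + s * y)]; its squared norm, computed from the
   three distances, vanishes. *)
pose k1 := (l - s) * (w1 - x1) - s * (y1 - w1).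
pose k2 := (l - s) * (w2 - x2) - s * (y2 - w2).
have k12 : k1 ^+ 2 + k2 ^+ 2 = 0.
  transitivity ((l - s) ^+ 2 * ((w1 - x1) ^+ 2 + (w2 - x2) ^+ 2)
    + s ^+ 2 * ((y1 - w1) ^+ 2 + (y2 - w2) ^+ 2)
    - s * (l - s) * ((x1 - y1) ^+ 2 + (x2 - y2) ^+ 2
       - ((w1 - x1) ^+ 2 + (w2 - x2) ^+ 2)
       - ((y1 - w1) ^+ 2 + (y2 - w2) ^+ 2))).
    by rewrite /k1 /k2; ring.
  by rewrite xw wy -xy; ring.
have k1_0 : k1 = 0.
  by apply/eqP; rewrite -sqrf_eq0; have := sqr_ge0 k1; have := sqr_ge0 k2; lra.
have k2_0 : k2 = 0.
  by apply/eqP; rewrite -sqrf_eq0; have := sqr_ge0 k1; have := sqr_ge0 k2; lra.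
transitivity (l * ((z1 - w1) ^+ 2 + (z2 - w2) ^+ 2)
  + 2 * ((z1 - w1) * k1 + (z2 - w2) * k2)).
  by rewrite k1_0 k2_0; ring.
transitivity ((l - s) * ((z1 - x1) ^+ 2 + (z2 - x2) ^+ 2)
   + s * ((z1 - y1) ^+ 2 + (z2 - y2) ^+ 2)
   - (l - s) * ((w1 - x1) ^+ 2 + (w2 - x2) ^+ 2)
   - s * ((y1 - w1) ^+ 2 + (y2 - w2) ^+ 2)).
  by rewrite /k1 /k2; ring.
by rewrite xw wy; ring.
Qed.

Section cn_spaces.
Context {R : realType} {T : metricType R}.
Local Notation d := (@mdist R T).

(** Completeness for geometrically fast sequences; [2 * C / 2 ^+ n] is the tail sum of the steps. *)
Definition geometrically_complete := forall (u : nat -> T) (C : R),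
  (forall n, d (u n) (u n.+1) <= C / 2 ^+ n) ->
  exists l, forall n, d (u n) l <= 2 * C / 2 ^+ n.

Definition satisfies_cn := forall z x y m, is_midpoint (R:=R) m x y ->
  2 * d z m ^+ 2 + d x y ^+ 2 / 2 <= d z x ^+ 2 + d z y ^+ 2.

Hypotheses (mid : @has_midpoints R T) (cn : satisfies_cn).

(** Bisection: [q n] holds the ends of a segment of length [l / 2 ^+ n] and the relative position in
    it of the point sought. *)
Lemma between_point x y (t : R) : geometrically_complete -> 0 <= t <= 1 ->
  exists c, d x c = t * d x y /\ d c y = (1 - t) * d x y.
Proof.
move=> cplt /andP[t0 t1].
have [m mP] := choice (fun xy => mid xy.1 xy.2).
pose step (q : T * T * R) := if q.2 <= 2^-1
  then (q.1.1, m q.1, 2 * q.2) else (m q.1, q.1.2, 2 * q.2 - 1).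
pose q n := iter n step (x, y, t).
pose l := d x y.
have inv n : [/\ d (q n).1.1 (q n).1.2 = l / 2 ^+ n, 0 <= (q n).2 <= 1,
    d x (q n).1.1 <= t * l - (q n).2 * (l / 2 ^+ n) &
    d (q n).1.2 y <= (1 - t) * l - (1 - (q n).2) * (l / 2 ^+ n)].
  elim: n => [|n]; first by rewrite /q/= divr1 !mdistxx !subrr t0 t1.
  rewrite /q iterS -/(q n); case: (q n) => -[a b] u /= [ab /andP[u0 u1] xa yb].
  have [] := mP (a, b); rewrite /= ab => am bm.
  have e2 : l / 2 ^+ n.+1 = l / 2 ^+ n / 2 by rewrite exprS invfM mulrA mulrAC.
  rewrite /step/= e2; case: (leP u) => u2 /=; split => //; try (apply/andP; split);
    try lra.
  - by have := metric_triangle (m (a, b)) b y; rewrite (metric_sym _ b); lra.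
  - by rewrite metric_sym.
  - by have := metric_triangle x a (m (a, b)); lra.
have aa n : d (q n).1.1 (q n.+1).1.1 <= l / 2 ^+ n.
  have l0 : 0 <= l / 2 ^+ n by rewrite divr_ge0 ?mdist_ge0 ?exprn_ge0.
  have [ab _ _ _] := inv n; rewrite /q iterS -/(q n) /step.
  case: (leP (q n).2) => _ /=; first by rewrite mdistxx.
  by rewrite (mP (q n).1).1 ab; lra.
have [c cP] := cplt _ _ aa; exists c.
have xc : d x c <= t * l.
  apply: (@le_of_forall_exp2 _ _ _ (2 * l)) => n.
  have := cP n; have [_ /andP[u0 _] xa _] := inv n.
  have : 0 <= (q n).2 * (l / 2 ^+ n).
    by rewrite mulr_ge0// divr_ge0 ?mdist_ge0 ?exprn_ge0.
  have := metric_triangle x (q n).1.1 c; lra.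
have cy : d c y <= (1 - t) * l.
  apply: (@le_of_forall_exp2 _ _ _ (3 * l)) => n.
  have := cP n; have [ab /andP[_ u1] _ yb] := inv n.
  have : 0 <= (1 - (q n).2) * (l / 2 ^+ n).
    by rewrite mulr_ge0 ?subr_ge0// divr_ge0 ?mdist_ge0 ?exprn_ge0.
  have := metric_triangle c (q n).1.1 y.
  have := metric_triangle (q n).1.1 (q n).1.2 y.
  rewrite ab (metric_sym c (q n).1.1) -[3 * l / _]mulrA -[2 * l / _]mulrA; lra.
(* The upper bounds [t * l] and [(1 - t) * l] add up to [d x y], so both are equalities. *)
have := metric_triangle x c y; rewrite -/l; split; lra.
Qed.

(** By CN the midpoint of distinct [c], [c'] would be strictly closer to both [x] and [y], against
    the triangle inequality. *)
Lemma between_point_unique x y c c' s : d x c = s -> d c y = d x y - s ->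
  d x c' = s -> d c' y = d x y - s -> c = c'.
Proof.
move=> xc cy xc' cy'; apply: mdist_positivity.
apply/eqP; rewrite eq_le mdist_ge0 andbT leNgt; apply/negP => cc'.
have [m mP] := mid c c'.
have := cn x mP; have := cn y mP.
rewrite !(metric_sym y) xc xc' cy cy' => ym xm.
have c2 : 0 < d c c' ^+ 2 by rewrite exprn_gt0.
have s0 : 0 <= s by rewrite -xc mdist_ge0.
have ls0 : 0 <= d x y - s by rewrite -cy mdist_ge0.
have : d x m < s.
  by rewrite -(@ltr_pXn2r _ 2)// ?nnegrE ?mdist_ge0//; lra.
have : d m y < d x y - s.
  by rewrite -(@ltr_pXn2r _ 2)// ?nnegrE ?mdist_ge0//; lra.
have := metric_triangle x m y; lra.
Qed.

Lemma cn_geodesic_space : geometrically_complete -> geodesic_space T.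
Proof.
move=> cplt x y; pose l := d x y.
have l0 : 0 <= l by exact: mdist_ge0.
have /choice[c cP] : forall s, exists c, 0 <= s <= l ->
    d x c = s /\ d c y = l - s.
  move=> s; have [sl|sl] := boolP (0 <= s <= l); last first.
    by exists x.
  have [l_eq0|l_neq0] := eqVneq l 0.
    exists x => _; move: sl; rewrite l_eq0 => sl.
    have -> : s = 0 by lra.
    by rewrite mdistxx -/l l_eq0 subrr.
  have lgt0 : 0 < l by rewrite lt_neqAle eq_sym l_neq0.
  have tl : 0 <= s / l <= 1.
    by rewrite ler_pdivlMr// mul0r ler_pdivrMr// mul1r.
  have [c [xc cy]] := between_point x y cplt tl.
  by exists c => _; rewrite xc cy -/l; split; field.
exists c; have P0 : (0 : R) <= 0 <= l by apply/andP; split.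
have Pl : 0 <= l <= l by apply/andP; split.
have mono s t : 0 <= s -> s <= t -> t <= l -> d (c s) (c t) = t - s.
  move=> s0 st tl; have [xct cty] := cP t (ltac:(lra)).
  have [xcs csy] := cP s (ltac:(lra)).
  have [t_eq0|t_neq0] := eqVneq t 0.
    have -> : s = t by lra.
    by rewrite mdistxx subrr.
  have tgt0 : 0 < t by rewrite lt_neqAle eq_sym t_neq0 (le_trans s0).
  have st1 : 0 <= s / t <= 1.
    by rewrite ler_pdivlMr// mul0r ler_pdivrMr// mul1r s0.
  (* The point at distance [s] on the way to [c t] is also on the way to [y]; uniqueness identifies
     it with [c s]. *)
  have [e [xe ect]] := between_point x (c t) cplt st1.
  have {}xe : d x e = s by rewrite xe xct; field.
  have {}ect : d e (c t) = t - s by rewrite ect xct; field.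
  have ey : d e y = l - s.
    have := metric_triangle e (c t) y; have := metric_triangle x e y.
    rewrite -/l; lra.
  by rewrite (between_point_unique xcs csy xe ey).
split.
- by apply/esym/mdist_positivity; have [-> _] := cP 0 P0.
- by apply: mdist_positivity; have [_ ->] := cP l Pl; rewrite subrr.
- move=> s t; rewrite !in_itv/= => /andP[s0 sl] /andP[t0 tl].
  have [st|/ltW ts] := leP s t; first by rewrite distrC mono// ger0_norm// subr_ge0.
  by rewrite metric_sym mono// ger0_norm// subr_ge0.
Qed.

(* The defect [psi] of the inequality vanishes at the endpoints and is midpoint
   convex, so halving towards the nearer endpoint gives [psi s <= psi s' / 2]. *)
Lemma cn_along_geodesic z x y c (s : R) : geodesic d x y c -> 0 <= s <= d x y ->
  d x y * d z (c s) ^+ 2 <=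
  (d x y - s) * d z x ^+ 2 + s * d z y ^+ 2 - s * (d x y - s) * d x y.
Proof.
move=> [c0 cl cd] sl; move: sl; set l := d x y => sl.
have l0 : 0 <= l by exact: mdist_ge0.
have cdist s1 s2 : 0 <= s1 -> s1 <= s2 -> s2 <= l -> d (c s1) (c s2) = s2 - s1.
  move=> s10 s12 s2l; rewrite cd ?in_itv/= ?s10 ?(le_trans s12)//.
    by rewrite distrC ger0_norm// subr_ge0.
  by rewrite (le_trans s10).
have cmid s1 s2 : 0 <= s1 -> s1 <= s2 -> s2 <= l ->
    is_midpoint (c ((s1 + s2) / 2)) (c s1) (c s2).
  move=> s10 s12 s2l; rewrite /is_midpoint (metric_sym (c s2)) !cdist//; lra.
pose psi s := l * d z (c s) ^+ 2 -
  ((l - s) * d z x ^+ 2 + s * d z y ^+ 2 - s * (l - s) * l).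
rewrite -subr_le0 -/(psi s).
(* [C] bounds [psi] on [[0, l]]; each halving gains a factor [1/2]. *)
pose C := l * (d z x + l) ^+ 2 + l * l * l.
apply: (@le_of_forall_exp2 _ _ _ C) => n; rewrite add0r.
elim: n s sl => [|n IH] s /andP[s0 sl].
  rewrite divr1 /psi /C.
  have : d z (c s) ^+ 2 <= (d z x + l) ^+ 2.
    rewrite ler_pXn2r// ?nnegrE ?mdist_ge0 ?addr_ge0 ?mdist_ge0//.
    have := metric_triangle z x (c s); rewrite -[in d x (c s)]c0 cdist//; lra.
  move=> /(ler_wpM2l l0).
  have : 0 <= (l - s) * d z x ^+ 2 by rewrite mulr_ge0 ?subr_ge0 ?sqr_ge0.
  have : 0 <= s * d z y ^+ 2 by rewrite mulr_ge0 ?sqr_ge0.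
  have : s * (l - s) * l <= l * l * l.
    by rewrite ler_wpM2r// ler_pM ?subr_ge0//; lra.
  lra.
have e2 : C / 2 ^+ n.+1 = C / 2 ^+ n / 2 by rewrite exprS invfM mulrA mulrAC.
rewrite e2; have [s2|s2] := leP s (l / 2).
- have sl2 : 0 <= 2 * s <= l by lra.
  have := IH _ sl2.
  have := cn z (cmid 0 (2 * s) (lexx 0) (ltac:(lra)) (ltac:(lra))).
  rewrite cdist//; [|lra|lra].
  have -> : (0 + 2 * s) / 2 = s by lra.
  rewrite c0 => /(ler_wpM2l l0); rewrite /psi; lra.
- have sl2 : 0 <= 2 * s - l <= l by lra.
  have := IH _ sl2.
  have := cn z (cmid (2 * s - l) l (ltac:(lra)) (ltac:(lra)) (lexx l)).
  rewrite cdist//; [|lra|lra].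
  have -> : (2 * s - l + l) / 2 = s by lra.
  rewrite cl => /(ler_wpM2l l0); rewrite /psi; lra.
Qed.

(** [cn_along_geodesic] on the left and [plane_stewart] on the right give the same expression,
    nondecreasing in the distances to the endpoints. *)
Lemma comparison_side z x y c (z' x' y' : 'rV[R]_2) c' (s : R) :
  geodesic d x y c -> geodesic (@plane_dist R) x' y' c' ->
  plane_dist x' y' = d x y -> 0 <= s <= d x y ->
  d z x <= plane_dist z' x' -> d z y <= plane_dist z' y' ->
  d z (c s) <= plane_dist z' (c' s).
Proof.
move=> gc gc' xy sl zx zy.
have [l0|l_neq0] := eqVneq (d x y) 0.
  have -> : s = 0 by lra.
  by case: gc => -> _ _; case: gc' => -> _ _.
have l0 : 0 < d x y by rewrite lt_neqAle eq_sym l_neq0 mdist_ge0.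
rewrite -(@ler_pXn2r _ 2)// ?nnegrE ?mdist_ge0 ?plane_dist_ge0//.
rewrite -(ler_pM2l l0) -{2}xy (le_trans (cn_along_geodesic z gc sl))//.
have sl' : 0 <= s <= plane_dist x' y' by rewrite xy.
rewrite (plane_stewart z' gc' sl') xy.
have : d z x ^+ 2 <= plane_dist z' x' ^+ 2.
  by rewrite ler_pXn2r ?nnegrE ?mdist_ge0 ?plane_dist_ge0.
have : d z y ^+ 2 <= plane_dist z' y' ^+ 2.
  by rewrite ler_pXn2r ?nnegrE ?mdist_ge0 ?plane_dist_ge0.
case/andP: sl => s0 sl; have ls0 : 0 <= d x y - s by rewrite subr_ge0.
move=> /(ler_wpM2l s0) + /(ler_wpM2l ls0); lra.
Qed.

Lemma ord3_cases (i k : 'I_3) : [\/ i = k, k = ordS i | i = ordS k].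
Proof.
by case: i k => -[|[|[|//]]] hi [[|[|[|//]]] hk];
  solve [apply: Or31; exact: val_inj | apply: Or32; exact: val_inj
        | apply: Or33; exact: val_inj].
Qed.

Lemma cn_CAT0 : geometrically_complete -> CAT0 T.
Proof.
move=> cplt; split; first exact: cn_geodesic_space.
move=> x c x' c' gt gt' xx' i j s t; rewrite !in_itv/= => si tj.
have vertices k k' : plane_dist (x' k) (x' k') = d (x k) (x k').
  case: (ord3_cases k k') => [->|->|->] //.
    by rewrite mdistxx plane_distxx.
  by rewrite plane_dist_sym xx' metric_sym.
(* The apex is first the vertex [x k] over the side [i], then the point [c i s] over the side
   [j]. *)
have side k : d (x k) (c i s) <= plane_dist (x' k) (c' i s).
  by apply: comparison_side (gt i) (gt' i) _ si _ _; rewrite vertices.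
by apply: comparison_side (gt j) (gt' j) _ tj _ _; rewrite ?vertices//
  metric_sym plane_dist_sym.
Qed.

End cn_spaces.

(** * Pretangent spaces *)

Section real_sequences.
Context {R : realType}.

Lemma cvgn_approx (u : nat -> R) :
  (forall e : R, 0 < e -> exists2 v : nat -> R, cvgn v &
    \forall n \near \oo, `|u n - v n| <= e) -> cvgn u.
Proof.
move=> uv; apply: cauchy_cvg; apply: cauchy_exP => e e0.
have e2 : 0 < e / 2 by rewrite divr_gt0.
have [v cv uve] := uv _ e2; exists (limn v); rewrite /ball/=.
near=> n.
have vl : `|limn v - v n| < e / 2 by near: n; exact: cvgr_dist_lt cv _ e2.
have uvn : `|u n - v n| <= e / 2 by near: n.
have := ler_distD (v n) (limn v) (u n).
rewrite (distrC (v n)) /ball_/=; lra.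
Unshelve. all: by end_near. Qed.

(* The subsequence is read off an ultrafilter, along which all the bounded
   sequences [w j] converge at once. *)
Lemma bounded_common_subsequence (w : nat -> nat -> R) (M : nat -> R) :
  (forall j n, `|w j n| <= M j) ->
  exists2 k, increasing_seq k & forall j, cvgn (w j \o k).
Proof.
move=> wM; have [U [UU ooU]] := @ultraFilterLemma _ (\oo : set_system nat) _.
have UF : ProperFilter U by exact: ultra_proper.
have /choice[L wL] : forall j, exists l, forall e : R, 0 < e ->
    U [set n | `|w j n - l| < e].
  move=> j; have [|l [_ lcl]] := @segment_compact R (- M j) (M j) (w j @ U) _.
    suff : U [set n | w j n \in `[- M j, M j]] by [].
    apply: filterE => n; have := wM j n.
    by rewrite /= in_itv/= ler_norml.
  exists l => e e0; have [//|UC] :=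
    in_ultra_setVsetC [set n | `|w j n - l| < e] UU.
  have [_ [[n nC <-] nl]] := lcl (w j @` ~` [set n | `|w j n - l| < e])
    (ball l e) (filterS (fun n nC => ex_intro2 _ _ n nC erefl) UC)
    (nbhsx_ballx _ _ e0).
  by case: nC; move: nl; rewrite /ball/= distrC.
(* [g (m, N)] is an index past [N] where the sequences [w 0], ..., [w m] are within [2^-m] of their
   limits; [k] iterates it. *)
have /choice[g gP] : forall mN : nat * nat, exists n, (mN.2 < n)%N /\
    forall j, (j <= mN.1)%N -> `|w j n - L j| < (2 ^+ mN.1)^-1.
  move=> [m N] /=.
  have Um : U [set n | forall j : 'I_m.+1, `|w j n - L j| < (2 ^+ m)^-1].
    by apply: filter_forall => j; apply: wL; rewrite invr_gt0 exprn_gt0.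
  have UN : U [set n | (N < n)%N] by apply: ooU; exists N.+1.
  have [n [/= nm Nn]] := filter_ex (filterI Um UN).
  by exists n; split => // j jm; exact: (nm (Ordinal (jm : (j < m.+1)%N))).
pose k := fix k m := if m is m'.+1 then g (m, k m') else g (0, 0)%N.
exists k; first by apply/increasing_seqP => m; rewrite ltEnat; exact: (gP _).1.
move=> j; apply/cvg_ex; exists (L j); apply/cvgrPdist_lt => e e0.
have [m em] := exists_lt_exp2 e^-1.
exists (maxn j m) => // n /=; rewrite geq_max => /andP[jn mn].
have kn : `|w j (k n) - L j| < (2 ^+ n)^-1.
  by case: n {mn} jn => [|n] jn; apply: (gP _).2.
rewrite distrC (lt_le_trans kn)// invf_ple ?posrE ?exprn_gt0//.
by rewrite (le_trans (ltW em))// ler_weXn2l// ler1n.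
Qed.

End real_sequences.

Section distance_ratios.
Context {R : realType} {X : metricType R} (r : normalizing_seq R).
Implicit Types x y z : nat -> X.

Definition dist_ratio x y n : R := mdist (x n) (y n) / r n.

Lemma dist_ratio_ge0 x y n : 0 <= dist_ratio x y n.
Proof. by rewrite divr_ge0 ?mdist_ge0// ltW ?nseq_gt0. Qed.

Lemma dist_ratio_sym x y n : dist_ratio x y n = dist_ratio y x n.
Proof. by rewrite /dist_ratio metric_sym. Qed.

Lemma dist_ratio_triangle y x z n : dist_ratio x z n <= dist_ratio x y n + dist_ratio y z n.
Proof.
rewrite -mulrDl ler_pM2r ?invr_gt0 ?nseq_gt0//.
exact: metric_triangle.
Qed.

Lemma dist_ratio_dist x y z n : `|dist_ratio x z n - dist_ratio y z n| <= dist_ratio x y n.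
Proof.
have := dist_ratio_triangle y x z n; have := dist_ratio_triangle x y z n.
by rewrite (dist_ratio_sym y x) ler_norml; lra.
Qed.

Lemma mutually_stable_sym x y : mutually_stable r x y -> mutually_stable r y x.
Proof.
rewrite /mutually_stable; suff -> : (fun n => mdist (x n) (y n) / r n) =
  (fun n => mdist (y n) (x n) / r n) by [].
by apply/funext => n; rewrite metric_sym.
Qed.

Lemma mutually_stablexx x : mutually_stable r x x.
Proof.
rewrite /mutually_stable (_ : (fun n => _) = cst 0); first exact: is_cvg_cst.
by apply/funext => n; rewrite mdistxx mul0r.
Qed.

Lemma mutually_stable_approx z y :
  (forall e : R, 0 < e -> exists2 x, mutually_stable r x y &
     \forall n \near \oo, dist_ratio z x n <= e) -> mutually_stable r z y.
Proof.
move=> zx; apply: cvgn_approx => e /zx[x xy zxe].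
exists (dist_ratio x y) => //; apply: filterS zxe => n.
exact: le_trans (dist_ratio_dist _ _ _ _).
Qed.

Lemma mutually_stable_sub x y k (ki : increasing_seq k) :
  mutually_stable r x y -> mutually_stable (nseq_sub r ki) (x \o k) (y \o k).
Proof.
move=> xy; apply/cvg_ex; exists (stable_dist r x y).
exact: (cvg_comp _ _ (increasing_seq_cvgn ki) xy).
Qed.

Lemma self_stable_extend (p : X) (B : set (nat -> X)) :
  self_stable r B -> B (fun=> p) -> exists F : stable_family p r, B `<=` F.
Proof.
move=> Bst Bp.
(* Zorn is applied to the part added to [B], so that the empty chain is covered by [Bst]. *)
have [C CD|A [Ast Amax]] :=
    @Zorn_bigcup _ [set A : set (nat -> X) | self_stable r (B `|` A)].
  move=> tot x y [Bx|[A CA Ax]] [By|[A' CA' A'y]].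
  - exact: Bst.
  - by apply: (CD _ CA'); [left|right].
  - by apply: (CD _ CA); [right|left].
  - have [AA'|A'A] := tot _ _ CA CA'.
    + by apply: (CD _ CA'); right => //; exact: AA'.
    + by apply: (CD _ CA); right => //; exact: A'A.
have Fmax : maximal_self_stable r (B `|` A).
  split=> // z Fz; apply: contrapT => nz.
  have zst x : (B `|` A) x -> mutually_stable r x z.
    by move=> Fx; apply: contrapT => xz; apply: nz; exists x.
  apply: (Amax (z |` A)).
    split; first by move=> x Ax; right.
    by move=> /(_ z (or_introl erefl)) Az; apply: Fz; right.
  have BzA x : (B `|` (z |` A)) x -> x = z \/ (B `|` A) x.
    by case=> [Bx|[->|Ax]]; [right; left|left|right; right].
  move=> x y /BzA[->|Fx] /BzA[->|Fy].
  - exact: mutually_stablexx.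
  - exact/mutually_stable_sym/zst.
  - exact: zst.
  - exact: Ast.
by exists (StableFamily Fmax (or_introl Bp)) => x Bx; left.
Qed.

End distance_ratios.

Section pretangent_spaces.
Context {R : realType} {X : metricType R} {p : X} {r : normalizing_seq R}.
Variable F : stable_family p r.
Implicit Types u v : pretangent F.

Definition rep u : nat -> X := val (repr u).

Lemma rep_in u : family_set F (rep u). Proof. exact: set_mem (valP (repr u)). Qed.

Lemma dist_ratio_rep_cvg u v : dist_ratio r (rep u) (rep v) @ \oo --> mdist u v.
Proof. exact: family_stable. Qed.

Lemma dist_ratio_const_cvg u : cvgn (dist_ratio r (rep u) (fun=> p)).
Proof. exact: (family_max F).1 (rep_in u) (family_const F). Qed.

Lemma rep_cvg u : rep u n @[n --> \oo] --> p.
Proof.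
apply/metricType_numDomainType.cvgrPdist_lt => e e0.
have : (fun n => dist_ratio r (rep u) (fun=> p) n * r n) @ \oo -->
    limn (dist_ratio r (rep u) (fun=> p)) * 0.
  by apply: cvgM; [exact: dist_ratio_const_cvg|exact: nseq_cvg0].
rewrite mulr0 => /cvgr0Pnorm_lt/(_ _ e0); apply: filterS => n.
rewrite /dist_ratio divfK ?gt_eqF ?nseq_gt0// ger0_norm ?mdist_ge0//.
by rewrite metric_sym.
Qed.

(** The diagonal sequence [z] is stable with respect to the family, hence belongs to it by
    maximality, and its class is the limit. *)
Lemma pretangent_geometrically_complete :
  geometrically_complete (T := pretangent F).
Proof.
move=> u C uC; pose x m := rep (u m).
have uu m k : mdist (u m) (u (m + k)%N) <= 2 * C / 2 ^+ m - 2 * C / 2 ^+ (m + k).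
  elim: k => [|k IH]; first by rewrite addn0 mdistxx subrr.
  have := metric_triangle (u m) (u (m + k)%N) (u (m + k).+1).
  rewrite addnS; have := uC (m + k)%N.
  have -> : 2 * C / 2 ^+ (m + k).+1 = C / 2 ^+ (m + k).
    by rewrite exprS; field; rewrite expf_neq0.
  rewrite -[2 * C / 2 ^+ (m + k)]mulrA in IH *; lra.
have C0 : 0 <= C by have := uC 0%N; rewrite divr1; exact: le_trans (mdist_ge0 _ _).
(* From [N m] on, the ratios between [x j], [j <= m], and [x m] exceed the bound on their limits by
   at most [2^-m]. *)
have /choice[N NP] : forall m, exists N, forall n, (N <= n)%N ->
    forall j, (j <= m)%N -> dist_ratio r (x j) (x m) n <= 2 * C / 2 ^+ j + (2 ^+ m)^-1.
  move=> m.
  have : \forall n \near \oo, forall j : 'I_m.+1,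
      dist_ratio r (x j) (x m) n <= 2 * C / 2 ^+ j + (2 ^+ m)^-1.
    apply: filter_forall => j; apply: (cvgr_le _ (@dist_ratio_rep_cvg (u j) (u m))).
    have := uu j (m - j)%N; rewrite subnKC ?leq_ord//.
    have : 0 < (2 ^+ m)^-1 :> R by rewrite invr_gt0 exprn_gt0.
    have : 0 <= 2 * C / 2 ^+ m by rewrite divr_ge0 ?exprn_ge0//; lra.
    lra.
  case=> N _ NP; exists N => n Nn j jm.
  exact: NP Nn (Ordinal (jm : (j < m.+1)%N)).
(* The witness is the largest [m <= n] with [N m <= n], with [0] as default. *)
have /choice[mu muP] : forall n, exists m, forall j, (j <= n)%N -> (N j <= n)%N ->
    (j <= m)%N /\ (N m <= n)%N.
  move=> n; have [[j [jn Njn]]|no] := pselect (exists j, (j <= n)%N /\ (N j <= n)%N).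
    have ex : exists j, (j <= n)%N && (N j <= n)%N by exists j; rewrite jn.
    have ub i : (i <= n)%N && (N i <= n)%N -> (i <= n)%N by case/andP.
    case: (ex_maxnP ex ub) => m /andP[mn Nm] mmax; exists m => i i_n Ni.
    by split => //; apply: mmax; rewrite i_n.
  by exists 0%N => j jn Nj; exfalso; apply: no; exists j.
pose z n := x (mu n) n.
have zx j : \forall n \near \oo, dist_ratio r (x j) z n <= 2 * C / 2 ^+ j + (2 ^+ j)^-1.
  exists (maxn j (N j)) => // n /=; rewrite geq_max => /andP[jn Njn].
  have [jm Nm] := muP n j jn Njn.
  have := NP _ _ Nm _ jm; rewrite /dist_ratio /z => /le_trans; apply.
  rewrite lerD2l lef_pV2 ?posrE ?exprn_gt0//.
  by rewrite ler_weXn2l// ler1n.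
have zst y : family_set F y -> mutually_stable r z y.
  move=> Fy; apply: mutually_stable_approx => e e0.
  have [j je] := exists_lt_exp2 ((2 * C + 1) / e).
  exists (x j); first exact: (family_max F).1 (rep_in _) Fy.
  apply: filterS (zx j) => n; rewrite dist_ratio_sym => /le_trans; apply.
  rewrite ltr_pdivrMr// in je; rewrite -[X in _ + X]mul1r -mulrDl.
  by rewrite ler_pdivrMr ?exprn_gt0// [e * _]mulrC ltW.
have Fz : family_set F z.
  apply: contrapT => /(family_max F).2[y Fy]; apply.
  exact/mutually_stable_sym/zst.
pose zf : family_seq F := exist _ z (mem_set Fz).
exists (\pi_(pretangent F) zf) => j.
rewrite -[u j]reprK /mdist/= pretangent_distE.
(* Since [mu n >= k] eventually, the slack [2^-(mu n)] is at most [2^-k]. *)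
apply: (@le_of_forall_exp2 _ _ _ 1) => k; rewrite div1r.
have jz : mutually_stable r (x j) z by exact/mutually_stable_sym/zst/rep_in.
apply: limr_le; first exact: jz.
exists (maxn (maxn j k) (maxn (N j) (N k))) => // n /=.
rewrite !geq_max => /andP[/andP[jn kn] /andP[Njn Nkn]].
have [jm Nm] := muP n j jn Njn; have [km _] := muP n k kn Nkn.
have := NP _ _ Nm _ jm; rewrite /dist_ratio /z => /le_trans; apply.
rewrite lerD2l lef_pV2 ?posrE ?exprn_gt0//.
by rewrite ler_weXn2l// ler1n.
Qed.

(** The maximum in [A1] gives way to the larger sum, so that the bound is polynomial in the
    distances and passes to the limit after division by [r n ^+ 2]. *)
Lemma A1_numerator_ge (e : R) (w x y z : X) : 0 <= e -> - e <= A1 p w x y z ->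
  0 <= mdist w x ^+ 2 + mdist x y ^+ 2 + mdist y z ^+ 2 + mdist z w ^+ 2
     - (mdist w y ^+ 2 + mdist x z ^+ 2)
     + e * (mdist w p + mdist x p + mdist y p + mdist z p) ^+ 2.
Proof.
move=> e0; rewrite /A1; case: eqP => [[-> -> -> ->] _|neq].
  by rewrite !mdistxx expr0n/= !addr0 subrr expr0n mulr0 addr0.
set M := Num.max _ _; set S := mdist w p + _ + _ + _.
have MS : M <= S.
  rewrite /M /S !ge_max.
  by have := (mdist_ge0 w p, mdist_ge0 x p, mdist_ge0 y p, mdist_ge0 z p);
    case=> -[[]]; lra.
have M0 : 0 < M.
  rewrite lt_neqAle; apply/andP; split; last first.
    by rewrite /M !le_max mdist_ge0.
  apply/negP => /eqP M0; apply: neq; move: (lexx M); rewrite -{2}M0 /M !ge_max.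
  have pos a : mdist a p <= 0 -> a = p.
    by move=> ap; apply: mdist_positivity; apply/eqP; rewrite eq_le ap mdist_ge0.
  by move=> /andP[/andP[/pos-> /pos->] /andP[/pos-> /pos->]].
rewrite ler_pdivlMr ?exprn_gt0//.
have : e * M ^+ 2 <= e * S ^+ 2 by rewrite ler_wpM2l// ler_pXn2r// nnegrE ltW// (lt_le_trans M0).
lra.
Qed.

Lemma pretangent_quadrilateral :
  (0 <= limf_einf (fun '(w, x, y, z) => (A1 p w x y z)%:E)
                  (nbhs (p, p, p, p)))%E ->
  quadrilateral_inequality (T := pretangent F).
Proof.
move=> A1_ge0 uw ux uy uz.
pose w := rep uw; pose x := rep ux; pose y := rep uy; pose z := rep uz.
pose P : nat -> X := fun=> p.
have stP u : dist_ratio r (rep u) P @ \oo --> limn (dist_ratio r (rep u) P).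
  exact: dist_ratio_const_cvg.
pose S := limn (dist_ratio r w P) + limn (dist_ratio r x P) + limn (dist_ratio r y P)
  + limn (dist_ratio r z P).
rewrite -subr_ge0; apply/ler_addgt0Pl => e e0.
(* Chosen so that [f * S ^+ 2 <= e], also when [S = 0]. *)
pose f : R := e / (S ^+ 2 + 1).
have S1 : 0 < S ^+ 2 + 1 by rewrite ltr_wpDl// sqr_ge0.
have f0 : 0 < f by rewrite divr_gt0.
have near_A1 : \forall n \near \oo, - f <= A1 p (w n) (x n) (y n) (z n).
  have : ((- f)%:E < limf_einf (fun '(w, x, y, z) => (A1 p w x y z)%:E)
                  (nbhs (p, p, p, p)))%E.
    by apply: lt_le_trans A1_ge0; rewrite lte_fin oppr_lt0.
  rewrite limf_einfE => /ereal_sup_gt[_ [V Vp <-] fV].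
  have : (fun n => (w n, x n, y n, z n)) @ \oo --> (p, p, p, p).
    exact: (cvg_pair (cvg_pair (cvg_pair (@rep_cvg uw) (@rep_cvg ux))
      (@rep_cvg uy)) (@rep_cvg uz)).
  move=> /(_ _ Vp) nV; have {}nV : \forall n \near \oo, V (w n, x n, y n, z n) by [].
  apply: filterS nV => n Vn.
  rewrite -lee_fin (le_trans (ltW fV))//; apply: ereal_inf_lbound.
  by exists (w n, x n, y n, z n).
pose q n := dist_ratio r w x n ^+ 2 + dist_ratio r x y n ^+ 2 + dist_ratio r y z n ^+ 2
  + dist_ratio r z w n ^+ 2 - (dist_ratio r w y n ^+ 2 + dist_ratio r x z n ^+ 2)
  + f * (dist_ratio r w P n + dist_ratio r x P n + dist_ratio r y P n + dist_ratio r z P n) ^+ 2.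
have q_ge0 : \forall n \near \oo, 0 <= q n.
  apply: filterS near_A1 => n /(A1_numerator_ge (ltW f0)).
  have r0 : 0 <= (r n)^-1 ^+ 2 by rewrite sqr_ge0.
  by move=> /(mulr_ge0 r0); rewrite /q /dist_ratio /P; congr (0 <= _); ring.
have sqr_cvg (a : nat -> R) (l : R) : a @ \oo --> l -> (fun n => a n ^+ 2) @ \oo --> l ^+ 2.
  by move=> al; rewrite expr2; under eq_fun do rewrite expr2; exact: cvgM.
have q_cvg : q @ \oo --> mdist uw ux ^+ 2 + mdist ux uy ^+ 2 + mdist uy uz ^+ 2
  + mdist uz uw ^+ 2 - (mdist uw uy ^+ 2 + mdist ux uz ^+ 2) + f * S ^+ 2.
  apply: cvgD; first apply: cvgB.
  - by do 3 (apply: cvgD; last exact/sqr_cvg/dist_ratio_rep_cvg);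
      exact/sqr_cvg/dist_ratio_rep_cvg.
  - by apply: cvgD; exact/sqr_cvg/dist_ratio_rep_cvg.
  - apply: cvgM; first exact: cvg_cst.
    by apply: sqr_cvg; do 3 (apply: cvgD; last exact: stP); exact: stP.
have : f * S ^+ 2 <= e.
  rewrite /f mulrAC ler_pdivrMr// ler_pM2l//; lra.
have := limr_ge (cvgP _ q_cvg) q_ge0; rewrite (cvg_lim _ q_cvg)//.
by move=> /(_ _); lra.
Qed.

End pretangent_spaces.

(** * Midpoints in separable tangent spaces *)

Section midpoints.
Context {R : realType} {X : metricType R} {p : X}.

(** At [x = y = p] the finite bound excludes [+oo] and forces [z = p]; elsewhere [delta_at] is at
    most the sum. *)
Lemma midpoint_defect_le (e : R) (x y z : X) : 0 <= e ->
  (midpoint_defect p x y z <= e%:E)%E ->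
  `|mdist x z - 2^-1 * mdist x y| <= e * (mdist x p + mdist y p).
Proof.
move=> e0; rewrite /midpoint_defect.
have [/andP[/eqP-> /eqP->]|] := boolP ((x == p) && (y == p)).
  case: eqP => [-> _|_]; last by rewrite leNgt ltry.
  by rewrite mdistxx mulr0 subrr normr0 addr0 mulr0.
move=> xyp; rewrite lee_fin; have D0 : 0 < delta_at p x y.
  rewrite /delta_at lt_max !mdist_gt0.
  by move: xyp; rewrite negb_and.
rewrite ler_pdivrMr// => /le_trans; apply; rewrite ler_wpM2l// /delta_at.
by rewrite ge_max; have := (mdist_ge0 x p, mdist_ge0 y p); case; lra.
Qed.

(** Divided by [r n], the midpoint error is at most a vanishing factor times two ratios to [p] that
    stay bounded. *)
Lemma midpoint_ratio_cvg (r : normalizing_seq R) (x y z : nat -> X) (l : R) :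
  cvgn (dist_ratio r x (fun=> p)) -> cvgn (dist_ratio r y (fun=> p)) ->
  dist_ratio r x y @ \oo --> l ->
  midpoint_defect p (x n) (y n) (z n) @[n --> \oo] --> 0%E ->
  dist_ratio r x z @ \oo --> l / 2.
Proof.
move=> xp yp xyl def0.
pose S := limn (dist_ratio r x (fun=> p)) + limn (dist_ratio r y (fun=> p)).
have S_cvg : (fun n => dist_ratio r x (fun=> p) n + dist_ratio r y (fun=> p) n) @ \oo --> S.
  by apply: cvgD; [exact: xp|exact: yp].
have S0 : 0 <= S.
  by rewrite addr_ge0// limr_ge//; apply: nearW => n; exact: dist_ratio_ge0.
have diff0 : (fun n => dist_ratio r x z n - 2^-1 * dist_ratio r x y n) @ \oo --> (0 : R).
  apply/cvgr0Pnorm_le => e e0.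
  have f0 : 0 < e / (S + 1) by rewrite divr_gt0// ltr_wpDl.
  have near_def : \forall n \near \oo,
      (midpoint_defect p (x n) (y n) (z n) <= (e / (S + 1))%:E)%E.
    have V0 : nbhs (0%E : \bar R) [set v | (v < (e / (S + 1))%:E)%E].
      by apply: open_nbhs_nbhs; split;
        [exact: open_ereal_lt_ereal|rewrite /= lte_fin].
    have nV : \forall n \near \oo,
      (midpoint_defect p (x n) (y n) (z n) < (e / (S + 1))%:E)%E by exact: def0 V0.
    by apply: filterS nV => n /ltW.
  have near_S : \forall n \near \oo,
      dist_ratio r x (fun=> p) n + dist_ratio r y (fun=> p) n <= S + 1.
    by apply: (cvgr_le _ S_cvg); rewrite ltrDl.
  apply: filterS2 near_def near_S => n /(midpoint_defect_le (ltW f0)) defn Sn.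
  have r0 : 0 < (r n)^-1 by rewrite invr_gt0 nseq_gt0.
  have -> : dist_ratio r x z n - 2^-1 * dist_ratio r x y n =
      (mdist (x n) (z n) - 2^-1 * mdist (x n) (y n)) / r n.
    by rewrite /dist_ratio; ring.
  rewrite normrM (gtr0_norm r0).
  rewrite (le_trans (ler_wpM2r (ltW r0) defn))// -mulrA mulrDl.
  rewrite (le_trans (ler_wpM2l (ltW f0) Sn))//.
  by rewrite divfK// gt_eqF// ltr_wpDl.
have -> : dist_ratio r x z = fun n => (dist_ratio r x z n - 2^-1 * dist_ratio r x y n) +
    2^-1 * dist_ratio r x y n by apply/funext => n; rewrite subrK.
rewrite [l / 2]mulrC -[2^-1 * l]add0r; apply: cvgD => //.
by apply: cvgM => //; exact: cvg_cst.
Qed.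

Context {r : normalizing_seq R} (F : stable_family p r).

Lemma separable_enum (u0 : pretangent F) : separable (pretangent F) ->
  exists e : nat -> pretangent F, forall (u : pretangent F) (eps : R), 0 < eps ->
    exists j, mdist u (e j) < eps.
Proof.
move=> [D /countable_injP[f finj] Dd].
(* [e j] is the element of [D] numbered [j] by [f], with [u0] as default. *)
have /choice[e eP] : forall j, exists v, forall v', D v' -> f v' = j -> v' = v.
  move=> j; have [[v [Dv fv]]|no] := pselect (exists v, D v /\ f v = j).
    by exists v => v' Dv' fv'; apply: finj; rewrite ?inE// fv.
  by exists u0 => v Dv fv; exfalso; apply: no; exists v.
exists e => u eps eps0.
have [|v [uv Dv]] := Dd (ball u eps)° _ (open_interior _).
  by exists u; exact: nbhsx_ballx.
exists (f v); rewrite -(eP _ _ Dv erefl).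
by have := interior_subset uv; rewrite ballEmdist.
Qed.

(* The infinitesimal midpoint is stable with respect to a countable dense set,
   hence to the whole family, along a subsequence; surjectivity of [em'] brings
   it back. *)
Lemma tangent_has_midpoints : midpoint_convex p -> tangent F ->
  separable (pretangent F) -> has_midpoints (T := pretangent F).
Proof.
move=> midX tanF sepF u v.
have [z [xz yz]] := midX _ _ (@rep_cvg _ _ _ _ F u) (@rep_cvg _ _ _ _ F v).
have xz_cvg : dist_ratio r (rep u) z @ \oo --> mdist u v / 2.
  apply: (@midpoint_ratio_cvg r (rep u) (rep v)) => //;
    [exact: dist_ratio_const_cvg|exact: dist_ratio_const_cvg|].
  exact: dist_ratio_rep_cvg.
have yz_cvg : dist_ratio r (rep v) z @ \oo --> mdist u v / 2.
  rewrite (metric_sym u v).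
  apply: (@midpoint_ratio_cvg r (rep v) (rep u)) => //;
    [exact: dist_ratio_const_cvg|exact: dist_ratio_const_cvg|].
  exact: dist_ratio_rep_cvg.
have [e e_dense] := separable_enum u sepF.
(* The triangle inequality through [rep u] bounds each ratio by a convergent sequence. *)
have /choice[M wM] : forall j, exists M, forall n, `|dist_ratio r (rep (e j)) z n| <= M.
  move=> j.
  have /cvg_has_ub[M Mb] : cvgn (fun n =>
      dist_ratio r (rep (e j)) (rep u) n + dist_ratio r (rep u) z n).
    by apply: is_cvgD; apply: cvgP; [exact: dist_ratio_rep_cvg|exact: xz_cvg].
  exists M => n; rewrite ger0_norm ?dist_ratio_ge0//.
  apply: le_trans (dist_ratio_triangle _ (rep u) _ _ _) _.
  by apply: le_trans (ler_norm _) _; apply: Mb; exists n.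
have [k ki wk] := bounded_common_subsequence wM.
pose r' := nseq_sub r ki.
have zst x : family_set F x -> mutually_stable r' (z \o k) (x \o k).
  move=> Fx; apply: mutually_stable_sym; apply: mutually_stable_approx => eps eps0.
  pose xf : family_seq F := exist _ x (mem_set Fx).
  have [j ej] := e_dense (\pi_(pretangent F) xf) eps eps0.
  exists (rep (e j) \o k); first exact: wk.
  have : dist_ratio r x (rep (e j)) @ \oo --> mdist (\pi_(pretangent F) xf) (e j).
    rewrite -{2}[e j]reprK /mdist/= pretangent_distE; exact: family_stable.
  move=> /(cvg_comp _ _ (increasing_seq_cvgn ki)) /cvgr_le/(_ _ ej).
  exact.
pose B := [set x \o k | x in family_set F] `|` [set z \o k].
have Bst : self_stable r' B.
  move=> _ _ [[x Fx <-]|->] [[y Fy <-]|->].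
  - exact/mutually_stable_sub/(family_max F).1.
  - exact/mutually_stable_sym/zst.
  - exact: zst.
  - exact: mutually_stablexx.
have Bp : B (fun=> p) by left; exists (fun=> p) => //; exact: family_const.
have [F' BF'] := self_stable_extend Bst Bp.
have FF' : [set x \o k | x in family_set F] `<=` family_set F'.
  by move=> x Fx; apply: BF'; left.
pose zf : family_seq F' := exist _ (z \o k) (mem_set (BF' _ (or_intror erefl))).
have [g gK1 gK2] := tanF k ki F' FF'.
pose m := g (\pi_(pretangent F') zf).
have dist_m w : dist_ratio r (rep w) z @ \oo --> mdist u v / 2 ->
    mdist w m = mdist u v / 2.
  move=> wz; rewrite -(pretangent_emb_isometry FF') gK2 /pretangent_emb.
  rewrite {1}/mdist/= pretangent_distE; apply: cvg_lim; first exact: Rhausdorff.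
  exact: (cvg_comp _ _ (increasing_seq_cvgn ki) wz).
by exists m; split; apply: dist_m.
Qed.

End midpoints.

Theorem mainTheorem1 (R : realType) (X : metricType R) (p : X)
  (midX : midpoint_convex p)
  (A1_ge0 : (0 <= limf_einf (fun '(w, x, y, z) => (A1 p w x y z)%:E)
                            (nbhs (p, p, p, p)))%E)
  (r : normalizing_seq R) (F : stable_family p r) :
  tangent F -> separable (pretangent F) -> CAT0 (pretangent F).
Proof.
move=> tanF sepF.
have mid := tangent_has_midpoints midX tanF sepF.
have quad := pretangent_quadrilateral (F := F) A1_ge0.
apply: (cn_CAT0 mid); last exact: pretangent_geometrically_complete.
by move=> z x y m; exact: cn_inequality.
Qed.
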